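(* Let $G$ be a finite simple graph on the vertex set $[n]=\{1,\dots,n\}$ and let $k$ be an infinite field. If the complement graph $\overline G$ is chordal, then $\operatorname{ms}(k(G))=\alpha(G)$. If $\overline G$ is not chordal, then $\operatorname{ms}(k(G))\le n-\operatorname{mcn}(G)+3$.
   Context: The edge ring of $G$ over $k$ is $k(G)=k[x_1,\dots,x_n]/I(G)$, where $I(G)=(x_ix_j\mid\{i,j\}\text{ is an edge of }G)$; it is standard graded with homogeneous maximal ideal $\bar{\mathfrak m}$ (the image of $(x_1,\dots,x_n)$). For a homogeneous ideal $J$ of $k(G)$, $\mu(J)=\dim_k(J/\bar{\mathfrak m}J)$, and $\operatorname{ms}(k(G))=\min\{\mu(J):J\subseteq\bar{\mathfrak m}\text{ a homogeneous ideal with }J\supseteq\bar{\mathfrak m}^2\}$. $\alpha(G)$ is the maximum size of an independent vertex set of $G$. $\overline G$ is the graph on $[n]$ whose edges are the non-edges of $G$. A finite simple graph is chordal if it has no induced subgraph isomorphic to a cycle graph $C_i$ with $i\ge4$. If $\overline G$ is not chordal, $\operatorname{mcn}(G)=\min\{i\ge4: \overline G\text{ has an induced subgraph isomorphic to }C_i\}$. *)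

(* Defs.v *)
From HB Require Import structures.
From mathcomp Require Import all_boot all_order all_algebra.
From mathcomp Require Import generic_quotient ring_quotient.
From mathcomp Require Import mpoly.
From mathcomp Require Import boolp.
Set Implicit Arguments.
Unset Strict Implicit.
Unset Printing Implicit Defensive.
Import GRing.Theory.
Local Open Scope ring_scope.
Local Open Scope quotient_scope.

(* Minima and dimensions are relations "... is equal to m" rather than functions,
   so that no default value is needed. *)
Definition is_least (P : nat -> Prop) (m : nat) : Prop :=
  P m /\ forall m', P m' -> (m <= m')%N.

Section Graphs.
Variable n : nat.
Implicit Type e : rel 'I_n.

(* The vertex set [n] = {1, ..., n} is represented by 'I_n = {0, ..., n-1}. *)
Definition simple_graph e : Prop := ssrbool.symmetric e /\ irreflexive e.

Definition compl_graph e : rel 'I_n := fun i j => (i != j) && ~~ e i j.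

Definition independent e (S : {set 'I_n}) : bool :=
  [forall i in S, forall j in S, ~~ e i j].

Definition alpha e : nat := (\max_(S : {set 'I_n} | independent e S) #|S|)%N.

(* ordS is the cyclic successor on 'I_i: this is the cycle graph C_i when i >= 3. *)
Definition cycle_rel (i : nat) : rel 'I_i :=
  fun a b => (b == ordS a) || (a == ordS b).

Definition has_induced_cycle e (i : nat) : Prop :=
  exists f : 'I_i -> 'I_n,
    injective f /\ forall a b, e (f a) (f b) = cycle_rel a b.

Definition chordal e : Prop :=
  forall i, (4 <= i)%N -> ~ has_induced_cycle e i.

Definition is_mcn e (c : nat) : Prop :=
  is_least (fun i => (4 <= i)%N /\ has_induced_cycle (compl_graph e) i) c.

End Graphs.

Section Ideals.
Variable R : comNzRingType.

Definition is_ideal (J : R -> Prop) : Prop :=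
  [/\ J 0, forall a b, J a -> J b -> J (a + b) & forall a b, J b -> J (a * b)].

Definition gen_ideal (S : R -> Prop) : R -> Prop := fun a =>
  exists s : seq (R * R),
    (forall t, t \in s -> S t.2) /\ a = \sum_(t <- s) t.1 * t.2.

Definition ideal_mul (I J : R -> Prop) : R -> Prop :=
  gen_ideal (fun a => exists x y, [/\ I x, J y & a = x * y]).

Lemma gen_ideal_lin (S : R -> Prop) a u v :
  gen_ideal S u -> gen_ideal S v -> gen_ideal S (a * u + v).
Proof.
move=> [s [sS ->]] [t [tS ->]].
exists ([seq (a * x.1, x.2) | x <- s] ++ t); split.
  move=> x; rewrite mem_cat => /orP [/mapP [y ys ->]|] /=; [exact: sS|exact: tS].
rewrite big_cat big_map mulr_sumr; congr (_ + _).
by apply: eq_bigr => x _; rewrite mulrA.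
Qed.

End Ideals.

(* d is the dimension of the quotient space A / B, for subspaces B <= A of V:
   some family of d elements of A maps to a basis of A / B. *)
Definition is_quot_dim (k : fieldType) (V : lmodType k) (A B : V -> Prop)
    (d : nat) : Prop :=
  exists v : 'I_d -> V,
    [/\ forall i, A (v i),
        forall a, A a -> exists c : 'I_d -> k, B (a - \sum_i c i *: v i)
      & forall c : 'I_d -> k, B (\sum_i c i *: v i) -> forall i, c i = 0].

Section EdgeRing.
Variables (k : fieldType) (n : nat) (e : rel 'I_n).

Definition edge_ideal_prop : {mpoly k[n]} -> Prop :=
  gen_ideal (fun p => exists i j, e i j /\ p = 'X_i * 'X_j).

(* {ideal_quot _} requires a boolean membership predicate. *)
Definition edge_ideal : {pred {mpoly k[n]}} := fun p => `[< edge_ideal_prop p >].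

(* 1 is not in I(G): all elements of I(G) vanish at the origin. *)
Lemma edge_ideal_closed : idealr_closed edge_ideal.
Proof.
split.
- by apply/asboolP; exists [::]; split=> //; rewrite big_nil.
- apply/asboolP => -[s [sS E]].
  have: (1 : {mpoly k[n]}).@[fun=> 0] = 0.
    rewrite E rmorph_sum big1_seq //= => t ts.
    have [i [j [_ ->]]] := sS _ ts.
    by rewrite !mevalM !mevalXU !mulr0.
  by rewrite meval1 => /eqP; rewrite oner_eq0.
- move=> a u v /asboolP Hu /asboolP Hv; apply/asboolP; exact: gen_ideal_lin.
Qed.

HB.instance Definition _ := isIdealr.Build _ edge_ideal edge_ideal_closed.

Definition edge_ring : Type := {ideal_quot edge_ideal}.
HB.instance Definition _ := GRing.ComNzRing.on edge_ring.

Definition edge_pi (p : {mpoly k[n]}) : edge_ring := \pi_({ideal_quot edge_ideal}) p.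

Lemma edge_pi_zmod : zmod_morphism edge_pi.
Proof. exact: (rmorphB (\pi_({ideal_quot edge_ideal}))). Qed.
Lemma edge_pi_monoid : monoid_morphism edge_pi.
Proof. exact: (pi_is_monoid_morphism {ideal_quot edge_ideal}). Qed.
HB.instance Definition _ :=
  GRing.isZmodMorphism.Build {mpoly k[n]} edge_ring edge_pi edge_pi_zmod.
HB.instance Definition _ :=
  GRing.isMonoidMorphism.Build {mpoly k[n]} edge_ring edge_pi edge_pi_monoid.

Definition edge_scale (c : k) (a : edge_ring) : edge_ring := edge_pi c%:MP * a.

Lemma edge_scaleA c d a : edge_scale c (edge_scale d a) = edge_scale (c * d) a.
Proof. by rewrite /edge_scale mulrA -rmorphM mpolyCM. Qed.
Lemma edge_scale1 : left_id 1 edge_scale.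
Proof. by move=> a; rewrite /edge_scale mpolyC1 rmorph1 mul1r. Qed.
Lemma edge_scaleDr : right_distributive edge_scale +%R.
Proof. by move=> c a b; rewrite /edge_scale mulrDr. Qed.
Lemma edge_scaleDl a : {morph edge_scale^~ a : c d / c + d}.
Proof. by move=> c d; rewrite /edge_scale mpolyCD rmorphD mulrDl. Qed.
HB.instance Definition _ := GRing.Zmodule_isLmodule.Build k edge_ring
  edge_scaleA edge_scale1 edge_scaleDr edge_scaleDl.

Definition edge_max : edge_ring -> Prop := fun a =>
  exists p, gen_ideal (fun q => exists i, q = 'X_i) p /\ a = edge_pi p.

Definition homog_elt (a : edge_ring) : Prop :=
  exists (d : nat) (p : {mpoly k[n]}), p \is d.-homog /\ a = edge_pi p.

Definition is_homog_ideal (J : edge_ring -> Prop) : Prop :=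
  is_ideal J /\ forall a, J a <-> gen_ideal (fun b => J b /\ homog_elt b) a.

Definition is_mu (J : edge_ring -> Prop) (d : nat) : Prop :=
  is_quot_dim J (ideal_mul edge_max J) d.

Definition is_ms (m : nat) : Prop :=
  is_least (fun d => exists J : edge_ring -> Prop,
    [/\ is_homog_ideal J,
        forall a, J a -> edge_max a,
        forall a, ideal_mul edge_max edge_max a -> J a
      & is_mu J d]) m.

End EdgeRing.

(* Main.v *)
(* Write H for the complement of G and R for k(G).

   Lower bound: restrict to an independent set S, i.e. to k[x_i : i in S].
   If an ideal J between m^2 and m is generated modulo mJ by v_1, ..., v_d whose
   linear parts have rank r, then m^2 <= J forces d - r relations among these
   linear parts to produce all the quadratic forms on their zero space in k^S,
   which has dimension |S| - r; hence |S| <= d.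

   Upper bound: an ideal with N homogeneous generators lying between m^2 and m
   has mu at most N.  If H is chordal, colour it with alpha(G) colours and take the
   sums of the variables over the colour classes: removing simplicial vertices
   one at a time, a product x_z x_v is the product of x_z with the sum over the
   class of v, up to products already in the ideal.  If H contains an induced
   cycle C of length c >= 4, take the variables outside C, two linear forms
   sum x_j and sum b_j x_j on C with the b_j distinct, and one edge of C; the
   linear forms make consecutive edges of C proportional modulo the ideal. *)
Require Import Defs.
From HB Require Import structures.
From mathcomp Require Import all_boot all_order all_algebra.
From mathcomp Require Import generic_quotient ring_quotient.
From mathcomp Require Import mpoly.
From mathcomp Require Import boolp.
From mathcomp Require Import zify.
Set Implicit Arguments.
Unset Strict Implicit.
Unset Printing Implicit Defensive.
Import GRing.Theory.

(** * Chordal graphs *)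

Section ChordalGraphs.
Variables (n : nat) (h : rel 'I_n).
Hypotheses (h_sym : ssrbool.symmetric h) (h_irr : irreflexive h).

(** Only the values of [g] at 0, ..., m count, and the two ends need not lie in [C]. *)
Definition walk (C : pred 'I_n) (x y : 'I_n) (m : nat) (g : nat -> 'I_n) : Prop :=
  [/\ g 0 = x, g m = y, forall i, i < m -> h (g i) (g i.+1)
    & forall i, 0 < i < m -> C (g i)].

Lemma walk_shortcut C x y m g i j : walk C x y m g ->
  i.+1 < j <= m -> h (g i) (g j) ->
  exists m' g', m' < m /\ walk C x y m' g'.
Proof.
move=> [g0 gm gE gC] ij hij.
exists (m - (j - i.+1)), (fun k => if k <= i then g k else g (k + (j - i.+1))).
split; first by lia.
split=> [|||l lm] /=.
- exact: g0.
- by rewrite ifF; [rewrite -gm; congr g; lia|lia].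
- move=> l lm; case: ltngtP => [li|li|->].
  + by rewrite gE //; lia.
  + by rewrite addSn gE //; lia.
  + by rewrite (_ : i.+1 + _ = j) //; lia.
- by case: ifP => li; apply: gC; lia.
Qed.

(** A shortest walk has no chords, so it is an induced path; [v] is adjacent to its two ends only,
    and adding [v] closes an induced cycle. As [x] and [y] are distinct and nonadjacent, m >= 2, and
    the cycle has m + 2 >= 4 vertices. *)
Lemma walk_to_cycle (C : pred 'I_n) v x y m g :
    walk C x y m g -> h v x -> h v y -> x != y -> ~~ h x y ->
    (forall u, C u -> (u != v) && ~~ h v u) ->
  exists2 i, 4 <= i & has_induced_cycle h i.
Proof.
move=> wk hvx hvy xy nxy CP.
have ex : exists m0, `[< exists g0, walk C x y m0 g0 >].
  by exists m; apply/asboolP; exists g.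
case: (ex_minnP ex) => {m g wk ex} m /asboolP [g wk] mmin.
have nochord i j : i.+1 < j <= m -> ~~ h (g i) (g j).
  move=> ij; apply/negP => hij.
  have [m' [g' [lt_m' wk']]] := walk_shortcut wk ij hij.
  by have /mmin := asboolT (ex_intro _ g' wk' : exists g0, walk C x y m' g0); lia.
case: wk => g0 gm gE gC.
have gV i : i <= m -> h v (g i) = (i == 0) || (i == m).
  move=> im; have [->|i0] := eqVneq i 0; first by rewrite g0 hvx.
  have [->|im'] := eqVneq i m; first by rewrite gm hvy.
  by apply/negbTE; case/andP: (CP _ (gC i ltac:(lia))).
have gNv i : i <= m -> g i != v.
  move=> im; have := gV i im.
  have [_|i0] := eqVneq i 0; last have [_|im'] := eqVneq i m.
  - by apply: contraTneq => ->; rewrite h_irr.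
  - by apply: contraTneq => ->; rewrite h_irr.
  - by move=> _; case/andP: (CP _ (gC i ltac:(lia))).
have ginj i j : i < j <= m -> g i != g j.
  move=> ij; have [jm|jm] := eqVneq j m; last first.
    apply/eqP => gij; have := gE j ltac:(lia); rewrite -gij.
    by apply/negP/nochord; lia.
  have := gV i; have := gV j; rewrite jm gm hvy.
  have [->|i0] := eqVneq i 0; first by rewrite g0.
  move=> _ gi; apply/eqP => giy; have := gi ltac:(lia); rewrite giy hvy; lia.
have m2 : 2 <= m.
  case: m => [|[|m]] // in gm gE {mmin nochord gC gV gNv ginj} *.
    by rewrite -gm g0 eqxx in xy.
  by have := gE 0 isT; rewrite g0 gm (negbTE nxy).
exists m.+2; first by lia.
pose F (i : nat) := if i <= m then g i else v.
exists (fun i : 'I_m.+2 => F i); split.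
  move=> i j; rewrite /F => Fij; apply/val_inj => /=; move: Fij.
  have := ltn_ord i; have := ltn_ord j.
  wlog: i j / i <= j.
    move=> W jm im Fij; have [ij|/ltnW ij] := leqP i j; first exact: W.
    by apply/esym; apply: W.
  move=> ij jm im; case: ifP => im'; case: ifP => jm' // E.
  - apply/eqP; rewrite eqn_leq ij /=; have [//|ji] := leqP j i.
    by have := ginj i j; rewrite ji jm' E eqxx => /(_ isT).
  - by have := gNv _ im'; rewrite E eqxx.
  - by lia.
  - by lia.
have symc (i j : 'I_m.+2) : cycle_rel i j = cycle_rel j i by rewrite /cycle_rel orbC.
move=> i j; wlog ij : i j / i <= j.
  move=> W; have [ij|/ltnW ij] := leqP i j; first exact: W.
  by rewrite h_sym symc; apply: W.
have ordSE (a : 'I_m.+2) : val (ordS a) = if a == m.+1 :> nat then 0 else a.+1.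
  rewrite /=; have := ltn_ord a; case: eqVneq => [->|aN alt].
    by rewrite modnn.
  by rewrite modn_small //; lia.
rewrite /cycle_rel -!val_eqE !ordSE /F /=.
have := ltn_ord i; have := ltn_ord j => jm im.
case: ifP => im'; case: ifP => jm'.
- have -> : (i == m.+1 :> nat) = false by lia.
  have -> : (j == m.+1 :> nat) = false by lia.
  have [<-|neq] := eqVneq (i : nat) j; first by rewrite h_irr; lia.
  have [ji|ji] := eqVneq (j : nat) i.+1; first by rewrite ji gE; lia.
  by rewrite (negbTE (nochord i j _)); lia.
- have -> : (i == m.+1 :> nat) = false by lia.
  have -> : (j == m.+1 :> nat) by lia.
  by rewrite h_sym gV //; lia.
- by lia.
- have -> : (i == m.+1 :> nat) by lia.
  have -> : (j == m.+1 :> nat) by lia.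
  by rewrite h_irr; lia.
Qed.

Lemma connect_walk (D : pred 'I_n) x y c1 c2 :
    D c1 -> connect [rel a b | [&& D a, D b & h a b]] c1 c2 ->
    h x c1 -> h c2 y ->
  exists m g, walk D x y m g.
Proof.
move=> Dc1 /connectP [p pth ->] hx hy.
(* The index [(size p).+2] lies past the end of the list, where [nth] returns its default [y]. *)
exists (size p).+2, (nth y (x :: c1 :: p)); split=> //=.
- by rewrite nth_default.
- case=> [|i] //= ip; rewrite ltnS ltnS in ip.
  case: (ltngtP i (size p)) ip => // [ip _|-> _].
    by have /(pathP y)/(_ i ip)/and3P[] := pth.
  by rewrite (nth_default y (leqnn _)) -[nth _ _ _](last_nth y c1 p).
- case=> [|[|i]] //= ip; rewrite !ltnS in ip.
  by have /(pathP y)/(_ i ip)/and3P[] := pth.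
Qed.

Definition simplicial (S : {set 'I_n}) (z : 'I_n) : Prop :=
  {in S &, forall u w, h z u -> h z w -> u != w -> h u w}.

Hypothesis h_chordal : chordal h.

(* Dirac's theorem, by strengthening: with C a connected component of the
   non-neighbourhood of v, the set N(C) is a clique, since two nonadjacent
   vertices of it would span an induced cycle with v and a shortest path
   through C.  One then recurses into C :|: N(C), which misses v. *)
Lemma far_simplicial (S : {set 'I_n}) v w :
    v \in S -> w \in S -> w != v -> ~~ h v w ->
  exists z, [/\ z \in S, z != v, ~~ h v z & simplicial S z].
Proof.
have [N] := ubnP #|S|; elim: N S v w => // N IH S v w leS vS wS wv nvw.
pose D : pred 'I_n := fun u => [&& u \in S, u != v & ~~ h v u].
pose r : rel 'I_n := [rel a b | [&& D a, D b & h a b]].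
pose C := [set u | D u && connect r w u].
pose NC := [set u in S | (u \notin C) && [exists c in C, h c u]].
have Dw : D w by apply/and3P.
have wC : w \in C by rewrite inE Dw connect0.
have CD u : u \in C -> D u by rewrite inE => /andP[].
have CS u : u \in C -> u \in S by move=> /CD /and3P[].
have NCS u : u \in NC -> u \in S by rewrite inE => /andP[].
have nbrC c u : c \in C -> u \in S -> h c u -> u \in C :|: NC.
  move=> cC uS cu; rewrite inE [u \in NC]inE uS; case: (u \in C) => //=.
  by apply/existsP; exists c; rewrite cC.
have NCv u : u \in NC -> h v u.
  rewrite inE => /and3P[uS uC /existsP[c /andP[cC cu]]].
  apply: contraR uC => nvu; have /and3P[_ cv nvc] := CD _ cC.
  have Du : D u.
    by apply/and3P; split=> //; apply: contraNneq nvc => <-; rewrite h_sym.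
  rewrite inE Du; move: (cC); rewrite inE => /andP[Dc wc].
  by apply: connect_trans wc (connect1 _); rewrite /r /= Dc Du.
have NCclique x y : x \in NC -> y \in NC -> x != y -> h x y.
  move=> xN yN xy; apply/negPn/negP => nxy.
  move: (xN) (yN); rewrite !inE.
  case/and3P=> _ _ /existsP[c1 /andP[c1C c1x]].
  case/and3P=> _ _ /existsP[c2 /andP[c2C c2y]].
  have symr : connect_sym r.
    by apply: sym_connect_sym => a b; rewrite /r /= h_sym andbCA.
  have c12 : connect r c1 c2.
    move: c1C c2C; rewrite !inE => /andP[_ w1] /andP[_ w2].
    by apply: connect_trans w2; rewrite symr.
  rewrite h_sym in c1x.
  have [m [g wk]] := connect_walk (CD _ c1C) c12 c1x c2y.
  have [|i i4 hi] := walk_to_cycle wk (NCv _ xN) (NCv _ yN) xy nxy.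
    by move=> u /and3P[_ -> ->].
  exact: h_chordal i4 hi.
(* All neighbours in [S] of a vertex of [C] lie in [C :|: NC], so simpliciality there carries over
   to [S]. *)
suff [z zC zs] : exists2 z, z \in C & simplicial (C :|: NC) z.
  have /and3P[zS zv nvz] := CD _ zC; exists z; split=> // a b aS bS za zb.
  by apply: zs => //; apply: nbrC zC _ _.
have ltS' : #|C :|: NC| < N.
  rewrite ltnS in leS; apply: leq_trans leS; apply/proper_card/properP; split.
    by apply/subsetP => u /setUP[/CS|/NCS].
  exists v => //; apply/setUP => -[/CD/and3P[]|/NCv]; last by rewrite h_irr.
  by rewrite eqxx.
(* If some [u1] in [NC] misses a vertex of [C :|: NC], the induction applies to [u1]: the vertex
   found is not adjacent to [u1], hence lies outside the clique [NC]. *)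
have [[u1 [u2 [u1N u2S u12 n12]]]|dom] :=
  pselect (exists u1 u2, [/\ u1 \in NC, u2 \in C :|: NC, u2 != u1 & ~~ h u1 u2]).
  have [|z [zS zu1 nz zs]] := IH _ u1 u2 ltS' _ u2S u12 n12.
    by rewrite inE u1N orbT.
  exists z => //; case/setUP: zS => // zN.
  by rewrite NCclique // eq_sym in nz.
have [[u1 [u2 [u1C u2C u12 n12]]]|clq] :=
  pselect (exists u1 u2, [/\ u1 \in C, u2 \in C, u2 != u1 & ~~ h u1 u2]).
  have [||z [zS zu1 nz zs]] := IH _ u1 u2 ltS' _ _ u12 n12.
  - by rewrite inE u1C.
  - by rewrite inE u2C.
  exists z => //; case/setUP: zS => // zN; case: dom; exists z, u1.
  by split=> //; [rewrite inE u1C|rewrite eq_sym|rewrite h_sym].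
(* Now [C :|: NC] is a clique, so [w] itself will do. *)
exists w => // a b aS bS wa wb ab; apply/negPn/negP => nab.
case/setUP: (aS) => aC; last by apply: dom; exists a, b; rewrite eq_sym.
case/setUP: (bS) => bC; last by apply: dom; exists b, a; rewrite h_sym.
by apply: clq; exists a, b; rewrite eq_sym.
Qed.

Lemma exists_simplicial (S : {set 'I_n}) :
  S != set0 -> exists2 z, z \in S & simplicial S z.
Proof.
case/set0Pn=> v vS.
have [[u [w [uS wS wu nuw]]]|clq] :=
  pselect (exists u w, [/\ u \in S, w \in S, w != u & ~~ h u w]).
  by have [z []] := far_simplicial uS wS wu nuw; exists z.
exists v => // a b aS bS va vb ab; apply/negPn/negP => nab.
by apply: clq; exists a, b; rewrite eq_sym.
Qed.

(** Greedy colouring: a simplicial vertex [z] is coloured last. With its neighbours in [S] it forms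
    a clique, so these block at most k - 1 colours. *)
Lemma chordal_coloring (k : nat) :
    (forall K : {set 'I_n}, {in K &, forall u w, u != w -> h u w} -> #|K| <= k) ->
  exists c : 'I_n -> nat,
    (forall u, c u < k) /\ (forall u w, h u w -> c u != c w).
Proof.
move=> Kk.
suff H (S : {set 'I_n}) : exists c : 'I_n -> nat,
    {in S, forall u, c u < k} /\ {in S &, forall u w, h u w -> c u != c w}.
  have [c [ck cP]] := H setT.
  by exists c; split=> [u|u w]; [apply: ck|apply: cP]; rewrite inE.
have [N] := ubnP #|S|; elim: N S => // N IH S leS.
have [->|/exists_simplicial[z zS zs]] := eqVneq S set0.
  by exists (fun=> 0); split=> u; rewrite inE.
have [|c [ck cP]] := IH (S :\ z); first by rewrite [#|S|](cardsD1 z) zS in leS.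
pose K := [set u in S | h z u].
have ltK : #|K| < k.
  have zK : z \notin K by rewrite inE h_irr andbF.
  apply: leq_trans (_ : #|z |: K| <= k); first by rewrite cardsU1 zK.
  apply: Kk => u w; rewrite !inE.
  case/predU1P=> [->|/andP[uS zu]]; case/predU1P=> [->|/andP[wS zw]] //.
  - by rewrite eqxx.
  - by rewrite h_sym.
  - exact: zs.
(* Pigeonhole: if every colour below [k] occurred on [K], then [K] would have at least k
   elements. *)
have [i ik iK] : exists2 i, i < k & i \notin [seq c u | u in K].
  apply/exists2P; apply: contrapT => noi; move: ltK; rewrite ltnNge => /negP; apply.
  rewrite -(size_iota 0 k) cardE -(size_map c (enum K)).
  apply: uniq_leq_size (iota_uniq _ _) _ => i; rewrite mem_iota /= => ik.
  by apply/negPn/negP => iK; apply: noi; exists i.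
have iKP u : u \in S -> h z u -> i != c u.
  move=> uS zu; apply: contraNneq iK => ->.
  by apply: map_f; rewrite mem_enum inE uS.
exists (fun u => if u == z then i else c u); split=> [u uS|u w uS wS uw].
  by case: eqVneq => // uz; apply: ck; rewrite !inE uz.
case: (eqVneq u z) uw => [->|uz]; case: (eqVneq w z) => [->|wz] uw.
- by rewrite h_irr in uw.
- exact: iKP.
- by rewrite eq_sym iKP // h_sym.
- by apply: cP => //; rewrite !inE ?uz ?wz.
Qed.
End ChordalGraphs.

Local Open Scope ring_scope.

(** * Ideals generated by a set, and dimensions of quotients *)

Section GeneratedIdeals.
Variable R : comNzRingType.
Implicit Types (J S : R -> Prop) (a b : R).

Lemma gen_ideal_ideal S : is_ideal (gen_ideal S).
Proof.
have S0 : gen_ideal S 0 by exists [::]; rewrite big_nil.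
split=> // [a b|a b] Sa.
  by move=> Sb; rewrite -[a]mul1r; apply: gen_ideal_lin.
by rewrite -[_ * _]addr0; apply: gen_ideal_lin.
Qed.

Lemma ideal0 J : is_ideal J -> J 0. Proof. by case. Qed.

Lemma idealD J a b : is_ideal J -> J a -> J b -> J (a + b).
Proof. by case=> _ + _; apply. Qed.

Lemma idealMl J a b : is_ideal J -> J b -> J (a * b).
Proof. by case=> _ _; apply. Qed.

Lemma idealMr J a b : is_ideal J -> J a -> J (a * b).
Proof. by rewrite mulrC; apply: idealMl. Qed.

Lemma idealB J a b : is_ideal J -> J a -> J b -> J (a - b).
Proof. by move=> Ji Ja Jb; apply: idealD => //; rewrite -mulN1r; apply: idealMl. Qed.

Lemma ideal_sum J (I : Type) (r : seq I) (P : pred I) (F : I -> R) :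
  is_ideal J -> (forall i, P i -> J (F i)) -> J (\sum_(i <- r | P i) F i).
Proof. by case=> J0 JD _ JF; elim/big_ind: _. Qed.

Lemma mem_gen_ideal S a : S a -> gen_ideal S a.
Proof.
move=> Sa; exists [:: (1, a)]; split=> [t|]; first by rewrite inE => /eqP->.
by rewrite big_seq1 mul1r.
Qed.

Lemma gen_ideal_min J S :
  is_ideal J -> (forall a, S a -> J a) -> forall a, gen_ideal S a -> J a.
Proof.
move=> Ji SJ a [s [sS ->]]; rewrite big_seq.
by apply: ideal_sum => // t /sS/SJ; apply: idealMl.
Qed.

Lemma mem_ideal_mul (I J : R -> Prop) a b : I a -> J b -> ideal_mul I J (a * b).
Proof. by move=> Ia Jb; apply: mem_gen_ideal; exists a, b. Qed.

End GeneratedIdeals.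

Lemma quot_dim_le (k : fieldType) (V : lmodType k) (A B : V -> Prop) (N : nat)
    (v : 'I_N -> V) :
    (forall c a b, B a -> B b -> B (c *: a + b)) ->
    (forall i, A (v i)) ->
    (forall a, A a -> exists c : 'I_N -> k, B (a - \sum_i c i *: v i)) ->
  exists2 d, (d <= N)%N & is_quot_dim A B d.
Proof.
move=> Blin; elim: N v => [|N IH] v vA vspan.
  by exists 0%N => //; exists v; split=> // c _ [].
have [indep|] := pselect (forall c, B (\sum_i c i *: v i) -> forall i, c i = 0).
  by exists N.+1 => //; exists v.
move/existsNP=> [c /not_implyP[Bc /existsNP[i0 /eqP ci0]]].
have [||d dN dP] := IH (v \o lift i0); last by exists d => //; apply: leqW.
  by move=> i; apply: vA.
(* Adding [t] times the relation to the expansion of [a] cancels the coefficient at [i0]. *)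
move=> a /vspan [c' Bc']; pose t := c' i0 / c i0.
exists (fun j => c' (lift i0 j) - t * c (lift i0 j)).
have := Blin t _ _ Bc Bc'; congr B.
rewrite addrCA -[in RHS]sub0r; congr (a + _); rewrite sub0r.
rewrite !(bigD1_ord i0) //= scalerDr scalerA divfK // scaler_sumr.
rewrite opprD addrACA subrr add0r -!sumrN -big_split /=.
by apply: eq_bigr => j _; rewrite scalerBl opprB scalerA.
Qed.

(** * The edge ring: its variables, its maximal ideal, and mu of an ideal with given generators *)

Section EdgeRingIdeals.
Variables (k : fieldType) (n : nat) (e : rel 'I_n).
Notation R := (edge_ring k e).

Definition evar (i : 'I_n) : R := edge_pi e 'X_i.

Lemma edge_piK (a : R) : exists p, a = edge_pi e p.
Proof. by exists (repr a); rewrite /edge_pi reprK. Qed.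

Lemma evar_edge i j : e i j -> evar i * evar j = 0.
Proof.
move=> eij; rewrite -rmorphM -(rmorph0 (@edge_pi k n e)) /edge_pi /=.
apply/eqP; rewrite -Quotient.idealrBE subr0; apply/asboolP.
by apply: mem_gen_ideal; exists i, j.
Qed.

Lemma edge_max_ideal : is_ideal (@edge_max k n e).
Proof.
have [m0 mD mM] := gen_ideal_ideal (fun q : {mpoly k[n]} => exists i, q = 'X_i).
split.
- by exists 0; rewrite rmorph0.
- move=> _ _ [p [pm ->]] [q [qm ->]]; exists (p + q).
  by rewrite rmorphD; split=> //; apply: mD.
- move=> a _ [q [qm ->]]; have [p ->] := edge_piK a; exists (p * q).
  by rewrite rmorphM; split=> //; apply: mM.
Qed.

Lemma evar_max i : edge_max (evar i).
Proof. by exists 'X_i; split=> //; apply: mem_gen_ideal; exists i. Qed.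

Lemma edge_maxE (a : R) : edge_max a -> exists g : 'I_n -> R, a = \sum_i g i * evar i.
Proof.
case=> p [pm ->].
suff [g ->] : exists g : 'I_n -> {mpoly k[n]}, p = \sum_i g i * 'X_i.
  exists (edge_pi e \o g); rewrite rmorph_sum.
  by apply: eq_bigr => i _; rewrite rmorphM.
case: pm => s [sX ->]; elim: s sX => [|t s IH] sX.
  by exists (fun=> 0); rewrite big_nil big1 // => i _; rewrite mul0r.
have [|g sE] := IH; first by move=> u us; apply: sX; rewrite inE us orbT.
have [i tE] := sX t (mem_head _ _).
exists (fun j => g j + (j == i)%:R * t.1); rewrite big_cons sE addrC.
rewrite [RHS](eq_bigr (fun j => g j * 'X_j + (j == i)%:R * t.1 * 'X_j)); last first.
  by move=> j _; rewrite mulrDl.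
rewrite big_split /=; congr (_ + _).
rewrite (bigD1 i) //= eqxx mul1r tE big1 ?addr0 // => j /negbTE->.
by rewrite !mul0r.
Qed.

(** The decomposition R = k + m: a monomial other than 1 is divisible by some variable. *)
Lemma edge_constP (a : R) : exists c x, edge_max x /\ a = edge_pi e c%:MP + x.
Proof.
have [p ->] := edge_piK a; elim/mpolyind: p => [|c m p _ _ [c' [x [xm pE]]]].
  exists 0, 0; split; first exact: ideal0 edge_max_ideal.
  by rewrite mpolyC0 addr0.
rewrite rmorphD /= pE.
have [->|m0] := eqVneq m 0%MM.
  exists (c + c'), x; split=> //; rewrite mpolyX0 -mul_mpolyC mulr1.
  by rewrite mpolyCD rmorphD addrA.
exists c', (edge_pi e (c *: 'X_[m]) + x); split; last by rewrite addrCA.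
apply: idealD xm; first exact: edge_max_ideal.
have [i mi] : exists i, m i != 0%N.
  apply/existsP; apply: contraNT m0; rewrite negb_exists => /forallP mi.
  by apply/eqP/mnmP => i; rewrite mnm0E; apply/eqP; have := mi i; rewrite negbK.
have -> : m = (m - U_(i) + U_(i))%MM.
  by rewrite submK //; apply/mnm_lepP => j; rewrite mnm1E; case: eqVneq => // <-; rewrite lt0n.
rewrite mpolyXD -mul_mpolyC mulrA rmorphM.
by apply: idealMl (evar_max i); apply: edge_max_ideal.
Qed.

Lemma scale_edgeE (c : k) (a : R) : c *: a = edge_pi e c%:MP * a.
Proof. by []. Qed.

Lemma homog_evar i : homog_elt (evar i).
Proof. by exists 1%N, 'X_i; rewrite dhomogX; split=> //; apply/eqP/mdeg1. Qed.

Definition mu_between (d : nat) : Prop :=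
  exists J : R -> Prop,
    [/\ is_homog_ideal J, forall a, J a -> edge_max a,
        forall a, ideal_mul (@edge_max k n e) (@edge_max k n e) a -> J a
      & is_mu J d].

(** The generators span J/mJ over k, because the part of a coefficient that lies in m contributes
    only to mJ. For m^2 <= J it suffices to test the products of two variables. *)
Lemma mu_gen_ideal (s : seq R) :
    (forall a, a \in s -> edge_max a /\ homog_elt a) ->
    (forall i j, gen_ideal (fun a => a \in s) (evar i * evar j)) ->
  exists2 d, (d <= size s)%N & mu_between d.
Proof.
move=> sP sX; pose J := gen_ideal (fun a => a \in s).
have Ji : is_ideal J := gen_ideal_ideal _.
have Js a : a \in s -> J a := @mem_gen_ideal _ (fun a => a \in s) a.
have mJi : is_ideal (ideal_mul (@edge_max k n e) J) := gen_ideal_ideal _.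
have mS i : J (nth 0 s i).
  have [lt_i|le_i] := ltnP i (size s); first by apply/Js/mem_nth.
  by rewrite nth_default //; apply: ideal0.
have [|||d ds dP] := @quot_dim_le k R J (ideal_mul (@edge_max k n e) J) (size s)
    (fun i => nth 0 s i).
- by move=> c a b Ba Bb; apply: idealD => //; rewrite scale_edgeE; apply: idealMl.
- by move=> i; apply: mS.
- move=> _ [t [ts ->]]; elim: t ts => [|[u g] t IH] ts.
    exists (fun=> 0); rewrite big_nil big1 ?subr0; first exact: ideal0.
    by move=> i _; rewrite scale0r.
  have [|c Bc] := IH; first by move=> x xt; apply: ts; rewrite inE xt orbT.
  have gs : g \in s := ts _ (mem_head _ _).
  have [c0 [x [xm ->]]] := edge_constP u.
  have gi : (index g s < size s)%N by rewrite index_mem.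
  exists (fun i => c i + (i == Ordinal gi)%:R * c0).
  rewrite big_cons (eq_bigr (fun i : 'I__ => c i *: nth 0 s i
    + ((i == Ordinal gi)%:R * c0) *: nth 0 s i)); last by move=> i _; rewrite scalerDl.
  rewrite big_split /= [X in _ - (_ + X)](bigD1 (Ordinal gi)) //= eqxx mul1r.
  rewrite [X in _ - (_ + (_ + X))]big1 ?addr0; last first.
    by move=> i /negbTE->; rewrite mul0r scale0r.
  rewrite nth_index // scale_edgeE mulrDl.
  set A := _ * g; set X := x * g; set T := \sum_(_ <- _) _; set S := \sum_(_ | _) _.
  have -> : A + X + T - (S + A) = X + (T - S).
    by rewrite [S + A]addrC opprD addrACA [A + X]addrC addrK.
  by apply: idealD => //; apply: mem_ideal_mul => //; apply: Js.
exists d => //; exists J; split=> //.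
- split=> // a; split=> [|[t [tJ ->]]]; last first.
    by rewrite big_seq; apply: ideal_sum => // x /tJ[Jx _]; apply: idealMl.
  apply: gen_ideal_min; first exact: gen_ideal_ideal.
  by move=> b bs; apply: mem_gen_ideal; split; [apply: Js|case: (sP b bs)].
- by apply: gen_ideal_min; [apply: edge_max_ideal|move=> a /sP[]].
- apply: gen_ideal_min => // _ [x [y [/edge_maxE[g ->] /edge_maxE[g' ->] ->]]].
  rewrite mulr_suml; apply: ideal_sum => // i _.
  rewrite mulr_sumr; apply: ideal_sum => // j _.
  by rewrite mulrACA; apply: idealMl => //; apply: sX.
Qed.

End EdgeRingIdeals.

(** * The lower bound *)

Section LowerBound.
Variables (k : fieldType) (n : nat) (e : rel 'I_n).
Notation R := (edge_ring k e).
Variables (s : nat) (f : 'I_s -> 'I_n).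
Hypotheses (f_inj : injective f) (f_indep : forall a b, e (f a) (f b) = false).

(* Evaluation along the line spanned by a point p of the coordinate subspace
   k^s: the i-th coefficient is the value at p of the degree i component. *)
Definition line_mpoly (p : 'I_s -> k) : {mpoly k[n]} -> {poly k} :=
  mmap (@polyC k) (fun i => (\sum_(a | f a == i) p a) *: 'X).

(** An edge has an end outside the image of [f], which is independent; the variable of that end is
    sent to an empty sum. So the evaluation descends to the edge ring. *)
Lemma line_mpoly_edge p q : edge_ideal_prop e q -> line_mpoly p q = 0.
Proof.
case=> t [te ->]; rewrite /line_mpoly rmorph_sum big1_seq //= => u ut.
have [i [j [eij ->]]] := te u ut; rewrite !rmorphM /= !mmapX !mmap1U.
have [a /eqP fa|noa] := pickP (fun a => f a == i); last first.
  by rewrite [X in X *: _]big_pred0 // scale0r mul0r mulr0.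
rewrite [X in _ * (_ * (X *: _))]big_pred0 ?scale0r ?mulr0 // => b.
by apply: contraTF eij => /eqP<-; rewrite -fa f_indep.
Qed.

Definition line_eval p (a : R) : {poly k} := line_mpoly p (repr a).

Lemma line_eval_pi p q : line_eval p (edge_pi e q) = line_mpoly p q.
Proof.
apply/eqP; rewrite -subr_eq0 /line_eval /line_mpoly -rmorphB; apply/eqP/line_mpoly_edge.
by apply/asboolP; rewrite -[`[< _ >]]/(_ \in edge_ideal e) Quotient.idealrBE reprK.
Qed.

Lemma line_eval_zmod p : zmod_morphism (line_eval p).
Proof.
move=> a b; have [q ->] := edge_piK a; have [q' ->] := edge_piK b.
by rewrite -rmorphB !line_eval_pi /line_mpoly rmorphB.
Qed.

Lemma line_eval_monoid p : monoid_morphism (line_eval p).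
Proof.
split=> [|a b]; first by rewrite -(rmorph1 (@edge_pi k n e)) line_eval_pi /line_mpoly rmorph1.
have [q ->] := edge_piK a; have [q' ->] := edge_piK b.
by rewrite -rmorphM !line_eval_pi /line_mpoly rmorphM.
Qed.

HB.instance Definition _ p :=
  GRing.isZmodMorphism.Build R {poly k} (line_eval p) (line_eval_zmod p).
HB.instance Definition _ p :=
  GRing.isMonoidMorphism.Build R {poly k} (line_eval p) (line_eval_monoid p).

Lemma line_evalC p c : line_eval p (edge_pi e c%:MP) = c%:P.
Proof. by rewrite line_eval_pi /line_mpoly mmapC. Qed.

Lemma line_evalZ p c a : line_eval p (c *: a) = c *: line_eval p a.
Proof. by rewrite scale_edgeE rmorphM /= line_evalC mul_polyC. Qed.

Lemma line_eval_var p i :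
  line_eval p (evar k e i) = (\sum_(a | f a == i) p a) *: 'X.
Proof. by rewrite line_eval_pi /line_mpoly mmapX mmap1U. Qed.

Lemma line_eval_var_f p b : line_eval p (evar k e (f b)) = p b *: 'X.
Proof.
by rewrite line_eval_var (big_pred1 b) // => a; rewrite (inj_eq f_inj).
Qed.

Lemma line_eval_max0 p (a : R) : edge_max a -> (line_eval p a)`_0 = 0.
Proof.
case/edge_maxE=> g ->; rewrite rmorph_sum coef_sum big1 // => i _ /=.
by rewrite rmorphM /= line_eval_var coef0M coefZ coefX mulr0 mulr0.
Qed.

(** Only the constant terms of the coefficients [g i] enter, and these do not depend on [p]; hence
    one linear form serves all lines. *)
Lemma line_eval_max1 (a : R) : edge_max a ->
  exists l : 'I_s -> k, forall p, (line_eval p a)`_1 = \sum_b l b * p b.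
Proof.
case/edge_maxE=> g ->.
have /choice[c cP] : forall i, exists c, forall p, (line_eval p (g i))`_0 = c.
  move=> i; have [c [x [xm ->]]] := edge_constP (g i); exists c => p.
  by rewrite rmorphD /= coefD line_evalC coefC line_eval_max0 // addr0.
exists (c \o f) => p; rewrite rmorph_sum coef_sum /=.
rewrite [RHS](partition_big f xpredT) //=; apply: eq_bigr => i _.
rewrite rmorphM /= line_eval_var -scalerAr coefZ coefMX /= cP mulrC mulr_sumr.
by apply: eq_bigr => b /eqP <-.
Qed.

Lemma line_evalM1 p (a b : R) : edge_max a -> edge_max b ->
  (line_eval p (a * b))`_1 = 0.
Proof.
move=> am bm; rewrite rmorphM coefM !big_ord_recl big_ord0 /=.
by rewrite !line_eval_max0 // mul0r mulr0 !addr0.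
Qed.

Lemma line_evalM2 p (a b : R) : edge_max a -> edge_max b ->
  (line_eval p (a * b))`_2 = (line_eval p a)`_1 * (line_eval p b)`_1.
Proof.
move=> am bm; rewrite rmorphM coefM !big_ord_recl big_ord0 /=.
by rewrite !(line_eval_max0 p) // mul0r mulr0 !addr0 add0r.
Qed.

(* The points p_j span the common zeros of the linear parts of v in k^s, and
   the squares of the dual linear forms are independent on them, so that their
   coordinates in v fill up the relations between these linear parts. *)
Lemma indep_le_mu (J : R -> Prop) (d : nat) :
    (forall a, J a -> edge_max a) ->
    (forall a, ideal_mul (@edge_max k n e) (@edge_max k n e) a -> J a) ->
    is_mu J d ->
  (s <= d)%N.
Proof.
move=> Jm mJ [v [vJ vspan _]].
have /choice[l lP] i := line_eval_max1 (Jm _ (vJ i)).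
(* Row i of [M] is the linear part of [v i]. The rows of [K] form a basis of the common zeros, so t
   = s - rank M. *)
pose M : 'M[k]_(d, s) := \matrix_(i, b) l i b.
pose K := row_base (kermx M^T); pose t := \rank (kermx M^T).
pose p j := K j.
have KM : K *m M^T = 0.
  by apply/sub_kermxP; rewrite eq_row_base.
have KL : K *m pinvmx K = 1%:M by rewrite mulmxVp ?row_base_free.
(* The right inverse of [K] supplies the linear forms dual to the points [p j]. *)
pose ell (j : 'I_t) : R := \sum_b pinvmx K b j *: evar k e (f b).
have ellm j : edge_max (ell j).
  apply: ideal_sum => [|b _]; first exact: edge_max_ideal.
  by rewrite scale_edgeE; apply: idealMl (evar_max _ _ _); apply: edge_max_ideal.
have ellp i j : (line_eval (p j) (ell i))`_1 = (i == j)%:R.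
  rewrite rmorph_sum coef_sum /=.
  transitivity ((K *m pinvmx K) j i); last by rewrite KL mxE eq_sym.
  rewrite mxE; apply: eq_bigr => b _.
  by rewrite line_evalZ line_eval_var_f !coefZ coefX mulr1 mulrC.
have vp j i : (line_eval (p j) (v i))`_1 = 0.
  rewrite lP; transitivity ((K *m M^T) j i); last by rewrite KM mxE.
  by rewrite mxE; apply: eq_bigr => b _; rewrite mulrC; congr (_ * _); rewrite !mxE.
(* The ring coefficients are absorbed into the factors from m. *)
have mJE z : ideal_mul (@edge_max k n e) J z ->
    exists2 w : seq (R * R), (forall u, u \in w -> edge_max u.1 /\ J u.2)
      & z = \sum_(u <- w) u.1 * u.2.
  case=> w [wP ->]; elim: w wP => [|u w IH] wP; first by exists [::]; rewrite ?big_nil.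
  rewrite big_cons; have [|w' w'P ->] := IH; first by move=> x xw; apply: wP; rewrite inE xw orbT.
  have [x [y [xm yJ uE]]] := wP u (mem_head _ _).
  exists ((u.1 * x, y) :: w'); last by rewrite big_cons uE mulrA.
  move=> u'; rewrite inE => /predU1P[->|/w'P//]; split=> //=.
  by apply: idealMl xm; apply: edge_max_ideal.
have mJ1 q z : ideal_mul (@edge_max k n e) J z -> (line_eval q z)`_1 = 0.
  move=> /mJE[w wP ->]; rewrite rmorph_sum coef_sum big1_seq //= => u /wP[um uJ].
  by rewrite line_evalM1 //; apply: Jm.
have coef_subv j q a c : (line_eval q (a - \sum_i c i *: v i))`_j
    = (line_eval q a)`_j - \sum_i c i * (line_eval q (v i))`_j.
  rewrite rmorphB coefB rmorph_sum /=; congr (_ - _); rewrite coef_sum.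
  by apply: eq_bigr => i _; rewrite line_evalZ coefZ.
(* Modulo mJ, which has no linear part, [a] is a combination of the [v i], whose linear parts vanish
   at [p j]. *)
have Jp j a : J a -> (line_eval (p j) a)`_1 = 0.
  case/vspan=> c /(mJ1 (p j)); rewrite coef_subv => /eqP; rewrite subr_eq0 => /eqP->.
  by rewrite big1 // => i _; rewrite vp mulr0.
have mJ2 j z : ideal_mul (@edge_max k n e) J z -> (line_eval (p j) z)`_2 = 0.
  move=> /mJE[w wP ->]; rewrite rmorph_sum coef_sum big1_seq //= => u /wP[um uJ].
  by rewrite line_evalM2 // ?(Jp _ u.2) ?mulr0 //; apply: Jm.
(* The row [c i] expands the square of [ell i] in the family [v]. Comparing quadratic parts at the
   points [p j] gives C Q = 1; comparing linear parts at the unit vectors gives C M = 0. *)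
have /choice[c cP] i := vspan _ (mJ _ (mem_ideal_mul (ellm i) (ellm i))).
pose C : 'M[k]_(t, d) := \matrix_(i, j) c i j.
pose Q : 'M[k]_(d, t) := \matrix_(i, j) (line_eval (p j) (v i))`_2.
have CQ : C *m Q = 1%:M.
  apply/matrixP => i j; have := mJ2 j _ (cP i); rewrite coef_subv line_evalM2 //.
  rewrite !ellp -natrM mulnb andbb => /eqP; rewrite subr_eq0 => /eqP E.
  by rewrite [RHS]mxE E mxE; apply: eq_bigr => i' _; rewrite !mxE.
have CM : C *m M = 0.
  apply/matrixP => i b; pose q a : k := (a == b)%:R.
  have := mJ1 q _ (cP i); rewrite coef_subv line_evalM1 // sub0r => /eqP.
  rewrite oppr_eq0 => /eqP E; rewrite [RHS]mxE -[RHS]E mxE; apply: eq_bigr => i' _.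
  rewrite !mxE lP (bigD1 b) //= /q eqxx mulr1 big1 ?addr0 // => a /negbTE ->.
  by rewrite mulr0.
(* The t independent rows of [C] are relations between the rows of [M], so s - rank M <= d - rank M;
   the two rank bounds rule out truncation in these differences. *)
have /mxrankS : (C <= kermx M)%MS by apply/sub_kermxP.
have : row_free C by apply/row_freeP; exists Q.
rewrite /row_free => /eqP-> ; rewrite /t !mxrank_ker mxrank_tr.
by have := rank_leq_row M; have := rank_leq_col M; lia.
Qed.
End LowerBound.

(** * The upper bounds *)

Lemma infinite_uniq_seq (T : eqType) :
  (forall s : seq T, exists x, x \notin s) ->
  forall m, exists2 s : seq T, uniq s & size s = m.
Proof.
move=> Tinf; elim=> [|m [s us <-]]; first by exists [::].
by have [x xs] := Tinf s; exists (x :: s) => //=; rewrite xs.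
Qed.

Section UpperBound.
Variables (k : fieldType) (n : nat) (e : rel 'I_n).
Hypothesis e_sym : ssrbool.symmetric e.
Notation R := (edge_ring k e).
Notation h := (compl_graph e).
Notation x := (evar k e).

Lemma compl_graph_sym : ssrbool.symmetric h.
Proof. by move=> i j; rewrite /compl_graph eq_sym e_sym. Qed.

Lemma compl_graph_irr : irreflexive h.
Proof. by move=> i; rewrite /compl_graph eqxx. Qed.

Lemma evar_nonadj i j : i != j -> ~~ h i j -> x i * x j = 0.
Proof. by move=> ij; rewrite /compl_graph ij negbK => /evar_edge. Qed.

Lemma scale_edgeAr (c : k) (a b : R) : a * (c *: b) = c *: (a * b).
Proof. by rewrite !scale_edgeE mulrCA. Qed.

Lemma ideal_scale (J : R -> Prop) c a : is_ideal J -> J a -> J (c *: a).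
Proof. by move=> Ji Ja; rewrite scale_edgeE; apply: idealMl. Qed.

Lemma linear_form (I : finType) (c : I -> k) (f : I -> 'I_n) :
  edge_max (\sum_i c i *: x (f i)) /\ homog_elt (\sum_i c i *: x (f i)).
Proof.
split.
  apply: ideal_sum => [|i _]; first exact: edge_max_ideal.
  by apply: ideal_scale (evar_max _ _ _); apply: edge_max_ideal.
exists 1%N, (\sum_i c i *: 'X_(f i)); split.
  apply: rpred_sum => i _; apply: dhomogZ.
  by rewrite dhomogX; apply/eqP/mdeg1.
rewrite rmorph_sum; apply: eq_bigr => i _.
by rewrite scale_edgeE -mul_mpolyC rmorphM.
Qed.

Lemma chordal_ms_le (w : nat) :
    chordal h ->
    (forall K : {set 'I_n}, {in K &, forall u v, u != v -> h u v} -> (#|K| <= w)%N) ->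
  exists2 d, (d <= w)%N & mu_between k e d.
Proof.
move=> h_chordal Kw.
have [c [cw cP]] := chordal_coloring compl_graph_sym compl_graph_irr h_chordal Kw.
pose theta i : R := \sum_u (c u == i)%:R *: x u.
have -> : w = size [seq theta i | i <- iota 0 w] by rewrite size_map size_iota.
apply: mu_gen_ideal => [a /mapP[i _ ->]|]; first exact: linear_form.
set J := gen_ideal _; have Ji : is_ideal J := gen_ideal_ideal _.
have Jtheta u : J (theta (c u)).
  by apply: mem_gen_ideal; apply: map_f; rewrite mem_iota cw.
(* [T] collects the vertices not yet settled; a vertex simplicial in [T] is settled next. *)
suff H (T : {set 'I_n}) : (forall u v, u \notin T -> J (x u * x v)) ->
    forall u v, J (x u * x v).
  by apply: (H setT) => u v; rewrite inE.
have [N] := ubnP #|T|; elim: N T => // N IH T leT TP.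
have [T0|] := eqVneq T set0; first by move=> u v; apply: TP; rewrite T0 inE.
case/(exists_simplicial compl_graph_sym compl_graph_irr h_chordal) => z zT zs.
apply: (IH (T :\ z)); first by rewrite [#|T|](cardsD1 z) zT in leT.
move=> u v; rewrite !inE negb_and negbK orbC => /orP[/TP//|/eqP-> {u}].
have [vT|] := boolP (v \in T); last by rewrite mulrC; apply: TP.
have [nzv|] := boolP ((z != v) && ~~ h z v).
  by case/andP: nzv => zv nzv; rewrite evar_nonadj //; apply: ideal0.
rewrite negb_and !negbK => zv.
have : J (x z * theta (c v)) by apply: idealMl.
rewrite mulr_sumr (bigD1 v) //= eqxx scale1r => Jzv.
(* In the remaining terms [u] has the colour of [v]. Either [u] is settled, or [x z * x u] vanishes:
   otherwise the simpliciality of [z] and the proper colouring would conflict. *)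
rewrite -[x z * x v](addrK (\sum_(u | u != v) x z * ((c u == c v)%:R *: x u))).
apply: idealB => //; apply: ideal_sum => // u uv; rewrite scale_edgeAr.
have [cuv|] := eqVneq (c u) (c v); last by rewrite scale0r => _; apply: ideal0.
rewrite scale1r; have [uT|] := boolP (u \in T); last by rewrite mulrC; apply: TP.
have [zu|zu] := eqVneq z u.
  rewrite zu; move: zv; rewrite zu (negbTE uv) /= => /cP.
  by rewrite cuv eqxx.
have [hzu|hzu] := boolP (h z u); last by rewrite evar_nonadj //; apply: ideal0.
case/orP: zv => [/eqP zv|hzv].
  by have := cP _ _ hzu; rewrite zv cuv eqxx.
by have := cP _ _ (zs u v uT vT hzu hzv uv); rewrite cuv eqxx.
Qed.

Lemma cycle_ms_le (c : nat) :
    (forall s : seq k, exists y : k, y \notin s) ->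
    (4 <= c)%N -> has_induced_cycle h c ->
  exists2 d, (d <= n - c + 3)%N & mu_between k e d.
Proof.
move=> k_inf c4 [f [f_inj f_cyc]].
have [bs bs_uniq bs_size] := infinite_uniq_seq k_inf c.
pose b (j : 'I_c) := bs`_j.
have b_inj : injective b.
  move=> i j /eqP; rewrite nth_uniq ?bs_size // => /eqP; exact: val_inj.
(* Writing the length as a successor makes [ord0] available as a starting vertex. *)
case: c c4 f bs_size b b_inj f_inj f_cyc => // c c4 f bs_size b b_inj f_inj f_cyc.
pose theta (t : 'I_c.+1 -> k) : R := \sum_j t j *: x (f j).
pose i0 : 'I_c.+1 := ord0.
pose F := [set f j | j in 'I_c.+1].
pose s := [seq x u | u in ~: F] ++
  [:: theta (fun=> 1); theta b; x (f i0) * x (f (ordS i0))].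
have -> : (n - c.+1 + 3)%N = size s.
  by rewrite size_cat size_map -cardE cardsCs setCK card_imset // !card_ord.
apply: mu_gen_ideal.
  move=> a; rewrite mem_cat => /orP[/imageP[u _ ->]|].
    by split; [apply: evar_max|apply: homog_evar].
  rewrite !inE => /or3P[] /eqP ->; [exact: linear_form|exact: linear_form|split].
    by apply: idealMl (evar_max _ _ _); apply: edge_max_ideal.
  exists 2%N, ('X_(f i0) * 'X_(f (ordS i0))); rewrite rmorphM; split=> //.
  by apply: (@dhomogM _ _ _ 1 _ 1); rewrite dhomogX; apply/eqP/mdeg1.
set J := gen_ideal _; have Ji : is_ideal J := gen_ideal_ideal _.
have Js a : a \in s -> J a := @mem_gen_ideal _ (fun a => a \in s) a.
have JF u : u \notin F -> J (x u).
  by move=> uF; apply: Js; rewrite mem_cat image_f // inE.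
have J1 : J (theta (fun=> 1)) by apply: Js; rewrite mem_cat !inE eqxx !orbT.
have Jb : J (theta b) by apply: Js; rewrite mem_cat !inE eqxx !orbT.
have J0 : J (x (f i0) * x (f (ordS i0))).
  have mem3 (a1 a2 a3 : R) : a3 \in [:: a1; a2; a3] by rewrite !inE eqxx !orbT.
  by apply: Js; rewrite mem_cat; apply/orP; right; apply: mem3.
have thetaB t : theta (fun j => b j - t) = theta b - t *: theta (fun=> 1).
  rewrite /theta scaler_sumr -sumrB; apply: eq_bigr => j _.
  by rewrite scalerBl scale1r.
have nonadj a j : j != a -> j != ordS a -> a != ordS j -> x (f a) * x (f j) = 0.
  move=> ja jSa aSj; apply: evar_nonadj; first by rewrite (inj_eq f_inj) eq_sym.
  by rewrite f_cyc /cycle_rel negb_or jSa.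
have ordS_neq (a : 'I_c.+1) : ordS a != a.
  rewrite -val_eqE /=; have := ltn_ord a; rewrite leq_eqVlt => /predU1P[aE|ac].
    by rewrite aE modnn; lia.
  by rewrite modn_small; lia.
(* In [x (f a')] times [theta b - b a' *: theta 1], the square cancels and only the two cycle edges
   at [a'] survive. The edge to [a] is in [J], and the other one has a nonzero coefficient since [b]
   is injective. *)
have JS (a : 'I_c.+1) :
    J (x (f a) * x (f (ordS a))) -> J (x (f (ordS a)) * x (f (ordS (ordS a)))).
  set a' := ordS a; set a2 := ordS a' => Ja.
  have : J (x (f a') * theta (fun j => b j - b a')).
    apply: idealMl => //; rewrite thetaB; apply: idealB => //.
    exact: ideal_scale.
  rewrite mulr_sumr (bigD1 a2) //= => Jsum.
  have : J (x (f a') * ((b a2 - b a') *: x (f a2))).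
    rewrite -[_ * _](addrK (\sum_(j | j != a2) x (f a') * ((b j - b a') *: x (f j)))).
    apply: idealB => //; apply: ideal_sum => // j ja2; rewrite scale_edgeAr.
    have [->|ja'] := eqVneq j a'; first by rewrite subrr scale0r; apply: ideal0.
    apply: ideal_scale => //.
    have [->|ja] := eqVneq j a; first by rewrite mulrC.
    rewrite nonadj //; first exact: ideal0.
    by rewrite (inj_eq (@ordS_inj _)) eq_sym.
  rewrite scale_edgeAr => /(ideal_scale (b a2 - b a')^-1 Ji).
  by rewrite scalerA mulVf ?scale1r // subr_eq0 (inj_eq b_inj) ordS_neq.
have Jedge (a : 'I_c.+1) : J (x (f a) * x (f (ordS a))).
  have iterS m : (m < c.+1)%N -> val (iter m (@ordS _) i0) = m.
    by elim: m => //= m IH mc; rewrite IH ?modn_small // ltnW.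
  rewrite -(_ : iter a (@ordS _) i0 = a); last exact/val_inj/iterS.
  by elim: (val a) => //= m; apply: JS.
(* In [x (f a)] times the sum of the cycle variables, every term but the square is zero or a cycle
   edge. *)
have Jsq (a : 'I_c.+1) : J (x (f a) * x (f a)).
  have : J (x (f a) * theta (fun=> 1)) by apply: idealMl.
  rewrite mulr_sumr (bigD1 a) //= scale1r => Jsum.
  rewrite -[_ * _](addrK (\sum_(j | j != a) x (f a) * (1 *: x (f j)))).
  apply: idealB => //; apply: ideal_sum => // j ja; rewrite scale1r.
  have [->|jSa] := eqVneq j (ordS a); first exact: Jedge.
  have [->|aSj] := eqVneq a (ordS j); first by rewrite mulrC; apply: Jedge.
  by rewrite nonadj //; apply: ideal0.
move=> u v; have [/imsetP[a _ ->]|uF] := boolP (u \in F); last first.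
  by apply: idealMr (JF _ uF).
have [/imsetP[a' _ ->]|vF] := boolP (v \in F); last first.
  by apply: idealMl (JF _ vF).
have [->|a'a] := eqVneq a' a; first exact: Jsq.
have [->|jSa] := eqVneq a' (ordS a); first exact: Jedge.
have [->|aSj] := eqVneq a (ordS a'); first by rewrite mulrC; apply: Jedge.
by rewrite nonadj //; apply: ideal0.
Qed.

End UpperBound.

(** * Existence of least values, and the comparison of the two bounds *)

Lemma is_least_exists (P : nat -> Prop) d :
  P d -> exists2 m, is_least P m & (m <= d)%N.
Proof.
move=> Pd; have ex : exists m, `[< P m >] by exists d; apply/asboolP.
case: (ex_minnP ex) => m /asboolP Pm mmin; exists m; last exact/mmin/asboolP.
by split=> // m' Pm'; apply/mmin/asboolP.
Qed.

Theorem proposition6p19 (k : fieldType) (n : nat) (e : rel 'I_n)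
    (k_infinite : forall s : seq k, exists x : k, x \notin s)
    (e_simple : simple_graph e) :
  (chordal (compl_graph e) -> is_ms k e (alpha e)) /\
  (~ chordal (compl_graph e) ->
     exists m c : nat, [/\ is_ms k e m, is_mcn e c & (m <= n - c + 3)%N]).
Proof.
have [e_sym e_irr] := e_simple.
split=> [h_chordal|].
  have lower d (J : edge_ring k e -> Prop) : (forall a, J a -> edge_max a) ->
      (forall a, ideal_mul (@edge_max k n e) (@edge_max k n e) a -> J a) ->
      is_mu J d -> (alpha e <= d)%N.
    (* The enumeration of an independent set [S] is the injection to which the lower bound
       applies. *)
    move=> Jm mJ Jd; apply/bigmax_leqP => S /forall_inP Sind.
    apply: (indep_le_mu (@enum_val_inj _ (mem S)) _ Jm mJ Jd) => a b.
    by have /forall_inP/(_ _ (enum_valP b))/negbTE := Sind _ (enum_valP a).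
  have [|d le_d [J JP]] := @chordal_ms_le k n e e_sym (alpha e) h_chordal.
    move=> K Kh; apply: (leq_bigmax_cond (F := fun S : {set 'I_n} => #|S|)).
    apply/forall_inP => u uK; apply/forall_inP => v vK.
    have [<-|uv] := eqVneq u v; first by rewrite e_irr.
    by have /andP[] := Kh u v uK vK uv.
  (* The ideal behind the upper bound is itself subject to the lower bound. *)
  have -> : alpha e = d.
    by apply/eqP; rewrite eqn_leq le_d andbT; case: JP => _ Jm mJ; apply: lower.
  split; first by exists J.
  by move=> d' [J' [_ Jm mJ Jd']]; apply: leq_trans le_d _; apply: lower Jm mJ Jd'.
(* A failure of chordality yields some induced cycle, hence a shortest one; its bound exhibits an
   attained value of mu, so the minimum ms exists. *)
move/existsNP=> [i /not_implyP[i4 /contrapT hi]].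
have [c cP _] := is_least_exists
  (conj i4 hi : (fun i => (4 <= i)%N /\ has_induced_cycle (compl_graph e) i) i).
have [[c4 hc] _] := cP.
have [d le_d dP] := cycle_ms_le k_infinite c4 hc.
have [m mP le_m] := is_least_exists dP.
by exists m, c; split=> //; apply: leq_trans le_d.
Qed.
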